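(* Suppose $\tilde f:\mathbb{R}^{N\cdot M}\to\mathbb{R}$, $\tilde f(y)=\sum_{\alpha=1}^{M}\sum_{i=1}^{N} f_i^{[\alpha]}(y_i^{[\alpha]})$, is a radially unbounded (i.e. $\tilde f(y)\to\infty$ as $\|y\|\to\infty$), twice continuously differentiable convex function, and $\varsigma:\mathbb{R}_{\ge 0}\to\mathbb{R}_{>0}$ is a locally integrable function satisfying the persistence condition $$\int_0^\infty\varsigma(\tau)\,d\tau=\infty\quad\text{and}\quad\lim_{t\to\infty}\varsigma(t)=0.$$ Then, for every initial condition $y(0)=y_0\in\mathbb{R}^{N\cdot M}$, the solution $y(t)$, $t\ge 0$, of the multiplex gradient dynamics $$\dot y=-\varsigma(t)\,\nabla_y\tilde f(y)-\mathcal{L}y$$ converges, as $t\to\infty$, to the single optimal solution $y^\star=x^\star 1_{N\cdot M}$, where $x^\star$ is the unique minimizer over $x\in\mathbb{R}$ of $\sum_{\alpha=1}^{M}\sum_{i=1}^{N}f_i^{[\alpha]}(x)$.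
   Context: Multiplex network: there are $N$ nodes $i\in V=\{1,\dots,N\}$ and $M$ layers $\alpha\in\mathcal{M}=\{1,\dots,M\}$; each pair $(i,\alpha)$ is a replica node. Within layer $\alpha$ there are symmetric nonnegative weights $w_{ij}^{[\alpha]}=w_{ji}^{[\alpha]}\ge 0$ (undirected intralinks) and an intralayer diffusion constant $D^{[\alpha]}>0$; between layers $\alpha\ne\beta$, each replica node $(i,\alpha)$ is linked to $(i,\beta)$ with interlayer diffusion constant $D^{[\alpha,\beta]}=D^{[\beta,\alpha]}\ge 0$. The vector $y\in\mathbb{R}^{N\cdot M}$ has entries $y_i^{[\alpha]}$ (stacked layer by layer). The supra-Laplacian $\mathcal{L}\in\mathbb{R}^{N\cdot M\times N\cdot M}$ is the symmetric matrix defined by $$(\mathcal{L}y)_i^{[\alpha]}=D^{[\alpha]}\sum_{j=1}^N w_{ij}^{[\alpha]}\,(y_i^{[\alpha]}-y_j^{[\alpha]})+\sum_{\beta\neq\alpha}D^{[\alpha,\beta]}\,(y_i^{[\alpha]}-y_i^{[\beta]}).$$ The multiplex network is assumed connected including interlinks: the graph on the $N\cdot M$ replica nodes whose edges are the links with positive coefficient ($D^{[\alpha]}w_{ij}^{[\alpha]}>0$ or $D^{[\alpha,\beta]}>0$) is connected. Standing assumptions on the costs: each $f_i^{[\alpha]}:\mathbb{R}\to\mathbb{R}$ is convex and differentiable with Lipschitz continuous derivative, and the problem $\min_{x\in\mathbb{R}}\sum_{\alpha=1}^{M}\sum_{i=1}^{N}f_i^{[\alpha]}(x)$ has a unique optimal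 solution $x^\star$. $1_{N\cdot M}$ is the all-ones vector in $\mathbb{R}^{N\cdot M}$. A solution of the time-varying differential equation is a locally absolutely continuous function satisfying it for almost every $t$ (a classical solution if $\varsigma$ is continuous). *)

(* Defs.v *)
From HB Require Import structures.
From mathcomp Require Import all_boot all_order all_algebra.
From mathcomp Require Import all_classical all_reals all_analysis.

Set Implicit Arguments.
Unset Strict Implicit.
Unset Printing Implicit Defensive.

Import Order.TTheory GRing.Theory Num.Theory.
Import numFieldNormedType.Exports.

Local Open Scope classical_set_scope.
Local Open Scope ring_scope.

(* Self-weights w_ii and the diagonal of [inter] are unconstrained: they never
   contribute to the supra-Laplacian. *)
Record multiplex (R : realType) (N M : nat) := Multiplex {
  weight : 'I_M -> 'I_N -> 'I_N -> R;
  intra : 'I_M -> R;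
  inter : 'I_M -> 'I_M -> R;
  weight_sym : forall a i j, weight a i j = weight a j i;
  weight_ge0 : forall a i j, 0 <= weight a i j;
  intra_gt0 : forall a, 0 < intra a;
  inter_sym : forall a b, a != b -> inter a b = inter b a;
  inter_ge0 : forall a b, a != b -> 0 <= inter a b
}.

Definition replica_link (R : realType) (N M : nat) (G : multiplex R N M) :
    rel ('I_M * 'I_N) := fun p q =>
  ((p.1 == q.1) && (0 < intra G p.1 * weight G p.1 p.2 q.2)) ||
  [&& p.2 == q.2, p.1 != q.1 & 0 < inter G p.1 q.1].

Definition multiplex_connected (R : realType) (N M : nat)
    (G : multiplex R N M) : Prop :=
  forall p q : 'I_M * 'I_N, connect (replica_link G) p q.

(* Entry y_i^[a] of a vector stacked layer by layer: [mxvec_index] is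
   row-major, so the entries of a layer are contiguous. *)
Definition entry (R : realType) (N M : nat) (y : 'cV[R]_(M * N))
    (a : 'I_M) (i : 'I_N) : R := y (mxvec_index a i) ord0.

Definition diffusion (R : realType) (N M : nat) (G : multiplex R N M)
    (y : 'cV[R]_(M * N)) (a : 'I_M) (i : 'I_N) : R :=
  intra G a * \sum_(j < N) weight G a i j * (entry y a i - entry y a j)
  + \sum_(b < M | b != a) inter G a b * (entry y a i - entry y b i).

(* The matrix whose q-th column is the image of the q-th basis vector under
   the linear map [diffusion G]; see [supra_laplacianE]. *)
Definition supra_laplacian (R : realType) (N M : nat) (G : multiplex R N M) :
    'M[R]_(M * N) :=
  \matrix_(p, q) (mxvec (\matrix_(a, i) diffusion G (delta_mx q ord0) a i))
                   ord0 p.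

Lemma supra_laplacianE (R : realType) (N M : nat) (G : multiplex R N M)
    (y : 'cV[R]_(M * N)) (a : 'I_M) (i : 'I_N) :
  entry (supra_laplacian G *m y) a i = diffusion G y a i.
Proof.
have entryE b k : entry y b k =
    \sum_q entry (delta_mx q ord0) b k * y q ord0.
  rewrite /entry (bigD1 (mxvec_index b k)) //= mxE !eqxx mul1r.
  rewrite big1 ?addr0// => q qbk.
  by rewrite mxE eq_sym (negbTE qbk) mul0r.
have subE b k c l : entry y b k - entry y c l =
    \sum_q (entry (delta_mx q ord0) b k - entry (delta_mx q ord0) c l)
           * y q ord0.
  by rewrite !entryE -sumrB; apply: eq_bigr => q _; rewrite mulrBl.
transitivity (\sum_q diffusion G (delta_mx q ord0) a i * y q ord0).
  by rewrite /entry mxE; apply: eq_bigr => q _; rewrite mxE mxvecE mxE.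
under eq_bigr do rewrite mulrDl -mulrA !mulr_suml.
rewrite big_split /= -mulr_sumr /diffusion; congr (_ * _ + _).
  rewrite exchange_big /=; apply: eq_bigr => j _; rewrite subE mulr_sumr.
  by apply: eq_bigr => q _; rewrite mulrA.
rewrite exchange_big /=; apply: eq_bigr => b _; rewrite subE mulr_sumr.
by apply: eq_bigr => q _; rewrite mulrA.
Qed.

Definition total_cost (R : realType) (N M : nat) (f : 'I_M -> 'I_N -> R -> R)
    (x : R) : R := \sum_(a < M) \sum_(i < N) f a i x.

Definition supra_cost (R : realType) (N M : nat) (f : 'I_M -> 'I_N -> R -> R)
    (y : 'cV[R]_(M * N)) : R := \sum_(a < M) \sum_(i < N) f a i (entry y a i).

Definition unique_minimizer (R : realType) (F : R -> R) (xs : R) : Prop :=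
  (forall x, F xs <= F x) /\
  (forall z, (forall x, F z <= F x) -> z = xs).

(* The library's norm on column vectors is the max norm, equivalent to the
   Euclidean one. *)
Definition radially_unbounded (R : realType) (n : nat) (F : 'cV[R]_n -> R) :
    Prop :=
  forall A : R, exists B : R, forall y : 'cV[R]_n, B <= `|y| -> A <= F y.

Definition gradient (R : realType) (n : nat) (F : 'cV[R]_n -> R)
    (y : 'cV[R]_n) : 'cV[R]_n :=
  \col_k derive (F : 'cV[R]_n -> R^o) y (delta_mx k ord0).

Definition hessian (R : realType) (n : nat) (F : 'cV[R]_n -> R)
    (y : 'cV[R]_n) : 'M[R]_n :=
  \matrix_(k, l) derive (gradient F) y (delta_mx l ord0) k ord0.

Definition twice_continuously_differentiable (R : realType) (n : nat)
    (F : 'cV[R]_n -> R) : Prop :=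
  [/\ forall y, differentiable (F : 'cV[R]_n -> R^o) y,
      forall y, differentiable (gradient F) y &
      continuous (hessian F)].

Definition absolutely_continuous (R : realType) (V : normedModType R)
    (s t : R) (y : R -> V) : Prop :=
  forall e : R, 0 < e -> exists2 d : R, 0 < d &
    forall (n : nat) (a b : 'I_n -> R),
      (forall k, [/\ s <= a k, a k <= b k & b k <= t]) ->
      trivIset setT (fun k => `]a k, b k[%classic) ->
      \sum_(k < n) (b k - a k) < d ->
      \sum_(k < n) `|y (b k) - y (a k)| < e.

(* Only the values of [y] on [0, +oo[ matter. The differential equation is
   required at almost every t > 0, where the two-sided derivative does not
   involve negative times. *)
Definition multiplex_gradient_solution (R : realType) (N M : nat)
    (G : multiplex R N M) (f : 'I_M -> 'I_N -> R -> R) (sigma : R -> R)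
    (y0 : 'cV[R]_(M * N)) (y : R -> 'cV[R]_(M * N)) : Prop :=
  [/\ y 0 = y0,
      forall s t, 0 <= s -> s <= t -> absolutely_continuous s t y &
      {ae @lebesgue_measure R, forall t : R, 0 < t ->
        is_derive (t : R^o) (1 : R^o) y
          (- (sigma t *: gradient (@supra_cost R N M f) (y t))
           - supra_laplacian G *m y t)}].

(* Main.v *)
Require Import Defs.
From HB Require Import structures.
From mathcomp Require Import all_boot all_order all_algebra.
From mathcomp Require Import all_classical all_reals all_analysis.
From mathcomp Require Import measurable_realfun lra ring.

Set Implicit Arguments.
Unset Strict Implicit.
Unset Printing Implicit Defensive.

Import Order.TTheory GRing.Theory Num.Theory.
Import numFieldNormedType.Exports.

Local Open Scope classical_set_scope.
Local Open Scope ring_scope.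

(** The replica nodes form one connected weighted graph, whose Laplacian is the
    supra-Laplacian, and every replica node p carries its own cost phi_p.  Write
    m for the mean of the state y, and consider

      V = sum_p (y_p - xs)^2   and   Q = sum_p (y_p - m)^2,

    so that V = Q + n (m - xs)^2, with n the number of replica nodes.

    Boundedness.  As the Laplacian is symmetric and positive semidefinite and
    kills the consensus states, the tangent inequality of the convex costs gives
    V' <= - 2 sigma (F(y) - F(xs 1)).  The right-hand side is nonpositive where y
    is large, because F is radially unbounded; hence V stays bounded.

    Consensus.  On a bounded set the gradient is bounded, its components being
    Lipschitz.  With the spectral gap lam of the connected graph,
    Q' <= C sigma - 2 lam Q, and sigma tends to 0: so Q tends to 0.

    Optimality.  If V > e while Q is small, the mean is away from xs, so F at the
    consensus state m exceeds its minimum over the consensus states by some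
    d > 0, uniformly, because a convex function on the line with a unique
    minimizer grows away from it.  The tangent inequality at m shows that F(y)
    exceeds F(xs 1) by d / 2 as soon as Q is small enough.  Therefore
    V' <= - sigma d as long as V > e, and since the integral of sigma diverges,
    V eventually falls below e and remains there.

    All three steps are instances of the same trapping principle
    ([ac_stay_below], [ac_eventually_below]): if h' <= - K' almost everywhere
    where h > eta, with K nondecreasing and unbounded, then h <= eta eventually.
    Since solutions are only absolutely continuous, this rests on the fact that
    an absolutely continuous function whose derivative is nonpositive almost
    everywhere is nonincreasing ([ac_nonincreasing]).  The other ingredients are
    the primitive of sigma ([primitive_derive], [primitive_unbounded]), the
    convexity estimates ([convex_tangent_le], [unique_minimizer_gap]) and the
    spectral gap ([graph_laplacian_gap]); [diffusive_gradient_flow_cvg] combines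
    them for an abstract diffusive gradient flow. *)

(** * Absolutely continuous functions with nonpositive derivative *)

(** The form of induction along a segment that lets a property cross any of its
    points: whether the point is reached from the left or left to the right,
    the step goes from some x1 <= x to some x2 >= x. *)
Lemma real_induction (R : realType) (s t : R) (P : R -> Prop) :
  s <= t -> P s ->
  (forall x, s <= x <= t -> exists2 r : R, 0 < r &
     forall x1 x2, s <= x1 -> x1 <= x <= x2 -> x2 <= t ->
       x - x1 < r -> x2 - x < r -> P x1 -> P x2) ->
  P t.
Proof.
move=> st Ps step.
pose S := [set x | s <= x <= t /\ P x].
have Ss : S s by split => //; rewrite lexx.
have ubS : ubound S t by move=> x [/andP[]].
have supS : has_sup S by split; [exists s|exists t].
have cS : s <= sup S <= t.
  by rewrite (ub_le_sup _ Ss) ?ge_sup//; [exists s|exists t].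
have [r r0 H] := step _ cS.
have [x1 [/andP[sx1 x1t] Px1] x1c] := sup_adherent r0 supS.
(* Were sup S < t, the step at sup S would lead to a point of S beyond it. *)
have x1c' : x1 <= sup S.
  by apply: ub_le_sup; [exists t|split => //; rewrite sx1].
pose x2 := Num.min t (sup S + r / 2).
have cx2 : sup S <= x2.
  by rewrite le_min; case/andP: cS => _ ->; rewrite lerDl divr_ge0// ltW.
have x2t : x2 <= t by rewrite ge_min lexx.
have Px2 : P x2.
  apply: (H x1 x2) => //; first by rewrite x1c'.
  - lra.
  - have : x2 <= sup S + r / 2 by rewrite ge_min lexx orbT.
    lra.
have : x2 <= sup S.
  apply: ub_le_sup; first by exists t.
  by split => //; rewrite x2t andbT; case/andP: cS => sc _; exact: le_trans cx2.
rewrite /x2; case: (leP t (sup S + r / 2)) => [tc|tc] x2c.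
  have {1}-> : t = x2 by rewrite /x2 min_l.
  exact: Px2.
lra.
Qed.

Lemma is_derive_near (R : realType) (h : R -> R) (x dh e : R) : 0 < e ->
  is_derive (x : R^o) (1 : R^o) (h : R^o -> R^o) dh ->
  exists2 r : R, 0 < r & forall z, `|z - x| < r ->
    `|h z - h x - dh * (z - x)| <= e * `|z - x|.
Proof.
move=> e0 [hd hv].
have : (fun k : R => k^-1 *: (h (k *: (1:R^o) + x) - h x)) @ 0^' --> dh.
  by rewrite -hv; exact: hd.
move=> /cvgrPdist_le/(_ e e0) [r /= r0 H].
exists r => // z zx.
have [->|zx0] := eqVneq z x; first by rewrite !subrr mulr0 subr0 !normr0 mulr0.
have zx0' : z - x != 0 by rewrite subr_eq0.
have /= := H (z - x).
rewrite sub0r normrN => /(_ zx zx0').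
rewrite [_%:A]mulr1 subrK /GRing.scale/= => H'.
have -> : h z - h x - dh * (z - x) =
    - (dh - (z - x)^-1 * (h z - h x)) * (z - x).
  by field.
by rewrite normrM normrN ler_wpM2r.
Qed.

(** The derivative condition may fail on a null set E, which is covered by an
    open set U of measure less than d.  Along [s, t], a point outside U allows
    h to grow by at most e per unit of length, while around a point of U the
    whole variation of h is charged to a new interval contained in U.  The
    intervals so collected are disjoint of total length at most the measure of
    U, hence absolute continuity bounds the variation charged to them by e. *)
Lemma ac_nonincreasing (R : realType) (s t : R) (h : R -> R) :
  s <= t -> absolutely_continuous s t (h : R -> R^o) ->
  {ae @lebesgue_measure R, forall x, s < x < t ->
     exists2 dh : R, dh <= 0 &
       is_derive (x : R^o) (1 : R^o) (h : R^o -> R^o) dh} ->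
  h t <= h s.
Proof.
move=> st ach [E [mE E0 badE]].
apply/ler_addgt0Pr => e0 e00.
pose e := e0 / (t - s + 1).
have ts1 : 0 < t - s + 1 by lra.
have egt0 : 0 < e by rewrite divr_gt0.
have [d d0 acd] := ach _ egt0.
pose mu := @lebesgue_measure R.


(* The endpoints join the exceptional set, since the derivative is known only
   in the open interval. *)
pose E' := E `|` ([set s] `|` [set t]).
have mE' : measurable E' by apply: measurableU => //; apply: measurableU.
have E'0 : mu E' = 0%E.
  apply: null_set_setU => //; first by apply: measurableU.
  by apply: null_set_setU => //; exact: lebesgue_measure_set1.
have [|U [oU EU muU]] := @lebesgue_regularity_outer R E' d mE' _ d0.
  by rewrite [X in (X < _)%E]E'0 ltry.
have mU : measurable U by exact: open_measurable.
have muUd : (mu U < d%:E)%E.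
  have -> : mu U = (mu E' + mu (U `\` E'))%E.
    rewrite -measureU ?setDIK ?setDUK//; exact: measurableD.
  by rewrite E'0 add0e.
(* P x: on [s, x] the growth of h is e times the length, up to the variation
   of h over disjoint intervals that lie in U. *)
pose P x := exists n (a b : 'I_n -> R),
  [/\ forall k, [/\ s <= a k, a k <= b k & b k <= x],
      trivIset setT (fun k => `]a k, b k[%classic),
      ((\sum_(k < n) (b k - a k))%:E <= mu (U `&` `[s, x]))%E &
      h x - h s <= e * (x - s) + \sum_(k < n) `|h (b k) - h (a k)|].
have Pmono x1 x2 : s <= x1 <= x2 -> h x2 - h x1 <= e * (x2 - x1) ->
    P x1 -> P x2.
  move=> /andP[sx1 x12] h12 [n [a [b [abx tr len hx]]]].
  exists n, a, b; split => //.
  - by move=> k; have [? ? bx] := abx k; split => //; exact: le_trans x12.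
  - apply: le_trans len _; apply: le_measure; rewrite ?inE.
    + exact: measurableI.
    + exact: measurableI.
    + by apply: setIS; apply: subset_itvl; rewrite bnd_simp.
  - move: hx h12; set S := \sum_(k < n) _; lra.
have Padd x1 x2 : s <= x1 <= x2 -> `]x1, x2[ `<=` U -> P x1 -> P x2.
  move=> /andP[sx1 x12] x12U [n [a [b [abx tr len hx]]]].
  exists n.+1, (fun k => if unlift ord_max k is Some j then a j else x1),
    (fun k => if unlift ord_max k is Some j then b j else x2); split.
  - move=> k; case: unliftP => [j|] _; last by split.
    by have [? ? bx] := abx j; split => //; exact: le_trans x12.
  - apply/trivIsetP => i j _ _.
    have dis k : `]a k, b k[ `&` `]x1, x2[ = set0.
      rewrite -subset0 => z/= []; rewrite !in_itv/= => /andP[_ zb] /andP[xz _].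
      by have [_ _] := abx k; rewrite leNgt (lt_trans xz zb).
    case: unliftP => [i'|] ->; case: unliftP => [j'|] -> ij.
    + move/trivIsetP : tr; apply => //.
      by apply: contraNneq ij => ->.
    + exact: dis.
    + by rewrite setIC dis.
    + by rewrite eqxx in ij.
  - rewrite big_ord_recr/= unlift_none.
    under eq_bigr => k _.
      rewrite (_ : widen_ord _ k = lift ord_max k) ?liftK; last first.
        by apply/val_inj; rewrite /= /bump leqNgt ltn_ord.
      over.
    rewrite EFinD.
    have muI : ((x2 - x1)%:E <= mu `]x1, x2[%classic)%E.
      rewrite /mu lebesgue_measure_itv/= lte_fin.
      case: ifPn => //; rewrite -leNgt => x21.
      by rewrite lee_fin subr_le0.
    apply: le_trans (leeD len muI) _.
    rewrite -measureU//; first last.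
      rewrite -subset0 => z/= [[_]]; rewrite !in_itv/= => /andP[_ zb] /andP[xz _].
      by move: xz; rewrite ltNge zb.
      exact: measurableI.
    apply: le_measure; rewrite ?inE//.
    + by apply: measurableU => //; exact: measurableI.
    + exact: measurableI.
    + move=> z [[Uz]|zx]/=; first by rewrite !in_itv/= => /andP[-> /le_trans->].
      split; first exact: x12U.
      move: zx; rewrite /= !in_itv/= => /andP[xz zx].
      by rewrite (le_trans sx1 (ltW xz)) ltW.
  - rewrite big_ord_recr/= unlift_none.
    under eq_bigr => k _.
      rewrite (_ : widen_ord _ k = lift ord_max k) ?liftK; last first.
        by apply/val_inj; rewrite /= /bump leqNgt ltn_ord.
      over.
    have : h x2 - h x1 <= `|h x2 - h x1| by exact: ler_norm.
    have : 0 <= e * (x2 - x1) by rewrite mulr_ge0 ?subr_ge0// ltW.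
    move: hx; set S := \sum_(k < n) _; lra.
have [n [a [b [abx tr len hx]]]] : P t.
  apply: (real_induction st).
    exists 0%N, (fun=> s), (fun=> s); split.
    + by case.
    + by move=> [].
    + by rewrite big_ord0 measure_ge0.
    + by rewrite big_ord0 !subrr mulr0 addr0.
  move=> x /andP[sx xt].
  have [Ux|nUx] := pselect (U x).
    have [r /= r0 rU] : nbhs x U by exact: open_nbhs_nbhs.
    exists r => // x1 x2 sx1 /andP[x1x xx2] x2t xr1 xr2.
    apply: Padd; first by rewrite sx1 (le_trans x1x xx2).
    move=> z; rewrite /= in_itv/= => /andP[xz zx]; apply: rU.
    rewrite /= ltr_norml; lra.
  have xst : s < x < t.
    rewrite !lt_neqAle sx xt !andbT; apply/andP.
    split; apply/eqP => xx; apply: nUx;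
      apply: EU; right; [left|right] => //.
  have [dh dh0 /(is_derive_near egt0)[r r0 H]] : exists2 dh : R, dh <= 0 &
      is_derive (x : R^o) (1 : R^o) (h : R^o -> R^o) dh.
    by apply: contrapT => nx; apply/nUx/EU; left; apply: badE => /(_ xst).
  exists r => // x1 x2 sx1 /andP[x1x xx2] x2t xr1 xr2.
  apply: Pmono; first by rewrite sx1 (le_trans x1x xx2).
  have /H : `|x1 - x| < r by rewrite ler0_norm ?subr_le0// opprB.
  have /H : `|x2 - x| < r by rewrite ger0_norm ?subr_ge0.
  rewrite [`|x2 - x|]ger0_norm ?subr_ge0// [`|x1 - x|]ler0_norm ?subr_le0//.
  rewrite !ler_norml => /andP[_ H2] /andP[H1 _].
  have D2 : dh * (x2 - x) <= 0 by rewrite mulr_le0_ge0 ?subr_ge0.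
  have D1 : 0 <= dh * (x1 - x) by rewrite mulr_le0 ?subr_le0.
  lra.
have : \sum_(k < n) `|h (b k) - h (a k)| < e.
  apply: acd => //.
  rewrite -lte_fin; apply: le_lt_trans len _; apply: le_lt_trans muUd.
  by apply: le_measure; rewrite ?inE//; exact: measurableI.
have : e * (t - s + 1) = e0 by rewrite /e divfK// gt_eqF.
move: hx; set S := \sum_(k < n) _; lra.
Qed.

(** * Operations on absolutely continuous functions *)

Section absolutely_continuous_theory.
Variables (R : realType) (V : normedModType R).
Implicit Types (s t : R) (y w : R -> V).

Lemma ac_sub s t s' t' y : s <= s' -> t' <= t ->
  absolutely_continuous s t y -> absolutely_continuous s' t' y.
Proof.
move=> ss' tt' acy e e0; have [d d0 H] := acy e e0; exists d => // n a b ab.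
apply: H => k; have [sa ? bt] := ab k; split => //.
  exact: le_trans sa.
exact: le_trans tt'.
Qed.

Lemma ac_unif_continuous s t y : absolutely_continuous s t y ->
  forall e : R, 0 < e -> exists2 d : R, 0 < d &
    forall x z, s <= x <= t -> s <= z <= t -> `|x - z| < d -> `|y x - y z| < e.
Proof.
move=> acy e e0; have [d d0 H] := acy e e0; exists d => //.
suff W x z : s <= x <= t -> s <= z <= t -> x <= z -> `|x - z| < d ->
    `|y x - y z| < e.
  move=> x z xst zst; have [xz|/ltW zx] := leP x z; first exact: W.
  by rewrite distrC => xzd; rewrite distrC; exact: W.
move=> /andP[sx xt] /andP[sz zt] xz xzd.
have := H 1%N (fun=> x) (fun=> z); rewrite !big_ord1 distrC; apply => //.
  by apply/trivIsetP => i j _ _; rewrite !ord1 eqxx.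
by move: xzd; rewrite ler0_norm ?subr_le0// opprB.
Qed.

Lemma ac_lipschitz s t (k : R) y :
  (forall x z, s <= x -> x <= z -> z <= t -> `|y z - y x| <= k * (z - x)) ->
  absolutely_continuous s t y.
Proof.
move=> yk e e0; exists (e / (`|k| + 1)).
  by rewrite divr_gt0// ltr_wpDl.
move=> n a b ab _; rewrite ltr_pdivlMr ?ltr_wpDl//; apply: le_lt_trans.
rewrite mulr_suml; apply: ler_sum => i _; have [sa abi bt] := ab i.
apply: (le_trans (yk _ _ sa abi bt)); rewrite mulrC ler_wpM2l ?subr_ge0//.
by rewrite (le_trans (ler_norm _))// lerDl.
Qed.

Lemma ac_cst s t (v : V) : absolutely_continuous s t (fun=> v).
Proof.
by apply: (@ac_lipschitz _ _ 0) => x z _ _ _; rewrite subrr normr0 mul0r.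
Qed.

Lemma acD s t y w :
  absolutely_continuous s t y -> absolutely_continuous s t w ->
  absolutely_continuous s t (fun x => y x + w x).
Proof.
move=> acy acw e e0; have e20 : 0 < e / 2 by rewrite divr_gt0.
have [d1 d10 H1] := acy _ e20; have [d2 d20 H2] := acw _ e20.
exists (Num.min d1 d2) => [|n a b ab tr]; first by rewrite lt_min d10.
rewrite lt_min => /andP[l1 l2].
apply: (@le_lt_trans _ _ (\sum_(k < n) `|y (b k) - y (a k)| +
    \sum_(k < n) `|w (b k) - w (a k)|)).
  rewrite -big_split/=; apply: ler_sum => i _.
  by rewrite opprD addrACA ler_normD.
by rewrite [ltRHS](splitr e) ltrD// ?H1 ?H2.
Qed.

Lemma ac_sum s t (J : finType) (y : J -> R -> V) :
  (forall j, absolutely_continuous s t (y j)) ->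
  absolutely_continuous s t (fun x => \sum_j y j x).
Proof.
move=> acy; elim: (index_enum J) => [|j r IH].
  have -> : (fun x => \sum_(j <- [::]) y j x) = fun=> 0.
    by apply/funext => x; rewrite big_nil.
  exact: ac_cst.
have -> : (fun x => \sum_(k <- j :: r) y k x) =
    fun x => y j x + \sum_(k <- r) y k x.
  by apply/funext => x; rewrite big_cons.
exact: acD.
Qed.

End absolutely_continuous_theory.

Section absolutely_continuous_real.
Variable R : realType.
Implicit Types (s t : R) (g h : R -> R).
Local Notation ac s t h := (@absolutely_continuous R R^o s t h).

Lemma ac_bounded s t h : ac s t h ->
  exists2 C : R, 0 <= C & forall x, s <= x <= t -> `|h x| <= C.
Proof.
move=> ach; have [ts|st] := ltP t s.
  by exists 0 => // x /andP[sx /(le_trans sx)]; rewrite leNgt ts.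
have [d d0 H] := ac_unif_continuous ach ltr01.
pose P x := exists2 C : R, 0 <= C & forall z, s <= z <= x -> `|h z| <= C.
suff : P t by [].
apply: (real_induction st).
  exists `|h s| => // z; rewrite -eq_le => /eqP ->//.
move=> x /andP[sx xt]; exists (d / 2); first by rewrite divr_gt0.
move=> x1 x2 sx1 /andP[x1x xx2] x2t xr1 xr2 [C C0 HC].
exists (C + 1); first by rewrite addr_ge0.
move=> z /andP[sz zx2].
have [zx1|x1z] := leP z x1.
  by rewrite (le_trans (HC z _)) ?sz ?zx1// lerDl.
rewrite -(subrK (h x1) (h z)) addrC (le_trans (ler_normD _ _))// lerD//.
  by rewrite HC// sx1 lexx.
apply/ltW/H.
- by rewrite sz (le_trans zx2).
- by rewrite sx1 (le_trans x1x).
- rewrite ger0_norm ?subr_ge0 ?ltW//; lra.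
Qed.

Lemma acM s t g h : ac s t g -> ac s t h -> ac s t (fun x => g x * h x).
Proof.
move=> acg ach; have [A A0 gA] := ac_bounded acg.
have [B B0 hB] := ac_bounded ach.
move=> e e0; pose e' := e / (A + B + 1).
have AB1 : 0 < A + B + 1 by lra.
have e'0 : 0 < e' by rewrite divr_gt0.
have [d1 d10 H1] := acg _ e'0; have [d2 d20 H2] := ach _ e'0.
exists (Num.min d1 d2) => [|n a b ab tr]; first by rewrite lt_min d10.
rewrite lt_min => /andP[l1 l2].
apply: (@le_lt_trans _ _ (B * (\sum_(k < n) `|g (b k) - g (a k)|) +
    A * (\sum_(k < n) `|h (b k) - h (a k)|))).
  rewrite !mulr_sumr -big_split/=; apply: ler_sum => i _.
  have [sa aib bt] := ab i.
  have -> : g (b i) * h (b i) - g (a i) * h (a i) =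
     h (b i) * (g (b i) - g (a i)) + g (a i) * (h (b i) - h (a i)) by ring.
  rewrite (le_trans (ler_normD _ _))// !normrM lerD// ler_wpM2r//.
    by rewrite hB// (le_trans sa).
  by rewrite gA// sa (le_trans aib).
have S1 := ltW (H1 n a b ab tr l1); have S2 := ltW (H2 n a b ab tr l2).
have -> : e = (A + B + 1) * e' by rewrite /e' mulrC divfK// gt_eqF.
have := ler_wpM2l A0 S2; have := ler_wpM2l B0 S1.
move: (\sum_(k < n) _) (\sum_(k < n) _) => *; lra.
Qed.

End absolutely_continuous_real.

(** * Trapping below a level *)

(** The differential inequality h' <= - K' is only required where h exceeds the
    level eta; [K] measures the time available for the descent. *)
Section trapping.
Variables (R : realType) (T eta : R) (h K : R -> R).
Hypothesis ach : forall t, T <= t -> absolutely_continuous T t (h : R -> R^o).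
Hypothesis acK : forall t, T <= t -> absolutely_continuous T t (K : R -> R^o).
Hypothesis ndK : forall x y, T <= x -> x <= y -> K x <= K y.
Hypothesis dhK : {ae @lebesgue_measure R, forall x, T < x -> eta < h x ->
  exists2 d : R, d <= 0 &
    is_derive (x : R^o) (1 : R^o) ((fun z => h z + K z) : R^o -> R^o) d}.

Let descent x y : T <= x -> x <= y -> (forall z, x < z <= y -> eta < h z) ->
  h y + K y <= h x + K x.
Proof.
move=> Tx xy hz.
apply: (@ac_nonincreasing R x y (fun z => h z + K z)) => //.
  apply: (@ac_sub _ _ T y) => //; apply: acD; [apply: ach|apply: acK];
  exact: le_trans xy.
have := dhK; apply: filterS; first 
  exact: (ae_filter_ringOfSetsType lebesgue_measure).
move=> z Hz /andP[xz zy]; apply: Hz.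
  exact: le_lt_trans xz.
by apply: hz; rewrite xz ltW.
Qed.

(** After the last time at which h <= eta, the sum h + K would be nonincreasing
    and K nondecreasing, so h cannot have grown. *)
Lemma ac_stay_below x y : T <= x -> x <= y -> h x <= eta -> h y <= eta.
Proof.
move=> Tx xy hx; rewrite leNgt; apply/negP => hy.
pose S := [set z | x <= z <= y /\ h z <= eta].
have Sx : S x by split => //; rewrite lexx.
have ubS : ubound S y by move=> z [/andP[]].
have supS : has_sup S by split; [exists x|exists y].
have xc : x <= sup S by apply: ub_le_sup => //; exists y.
have cy : sup S <= y by apply: ge_sup => //; exists x.
have hc : h (sup S) <= eta.
  rewrite leNgt; apply/negP => hc; have := hc; rewrite -subr_gt0 => e0.
  have [d d0 H] := ac_unif_continuous (ach (le_trans Tx xy)) e0.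
  have [z [/andP[xz zy] hz] zc] := sup_adherent d0 supS.
  have zc' : z <= sup S by apply: ub_le_sup; [exists y|split => //; rewrite xz].
  have := H (sup S) z; rewrite (le_trans Tx xc) cy (le_trans Tx xz) zy.
  rewrite ger0_norm ?subr_ge0// => /(_ isT isT) H'.
  have : `|h (sup S) - h z| < h (sup S) - eta by apply: H'; lra.
  have := ler_norm (h (sup S) - h z); lra.
have : h y + K y <= h (sup S) + K (sup S).
  apply: descent => //; first exact: le_trans xc.
  move=> z /andP[cz zy]; rewrite ltNge; apply/negP => hz.
  have : z <= sup S.
    apply: ub_le_sup; first by exists y.
    by split => //; rewrite zy andbT (le_trans xc (ltW cz)).
  by rewrite leNgt cz.
have := ndK (le_trans Tx xc) cy; lra.
Qed.

(** As long as h > eta, the function h decreases by at least the growth of K,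
    which is unbounded. *)
Lemma ac_eventually_below : (forall A, exists2 t, T <= t & A <= K t) ->
  exists2 t0, T <= t0 & forall t, t0 <= t -> h t <= eta.
Proof.
move=> Koo.
suff [t0 Tt0 ht0] : exists2 t0, T <= t0 & h t0 <= eta.
  by exists t0 => // t t0t; exact: ac_stay_below ht0.
apply: contrapT => nex.
have hT z : T <= z -> eta < h z.
  by move=> Tz; rewrite ltNge; apply/negP => hz; apply: nex; exists z.
have [t Tt] := Koo (h T + K T - eta).
have := @descent T t (lexx _) Tt (fun z zt => hT z (ltW (proj1 (andP zt)))).
have := hT _ Tt; lra.
Qed.

End trapping.

(** * The primitive of the step size *)

Section primitive.
Variables (R : realType) (sigma : R -> R).
Local Notation mu := (@lebesgue_measure R).
Hypothesis sigma_ge0 : forall t, 0 <= t -> 0 <= sigma t.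
Hypothesis sigma_int : forall t, 0 <= t -> mu.-integrable `[0, t] (EFin \o sigma).

Definition primitive (x : R) : R := (\int[mu]_(t in `[0%R, x]) sigma t)%R.

Lemma primitiveB x y : 0 <= x -> x <= y ->
  primitive y - primitive x = (\int[mu]_(t in `]x, y]) sigma t)%R.
Proof.
move=> x0 xy; apply: Rintegral_itvB; rewrite ?bnd_simp//.
by apply: sigma_int; exact: le_trans xy.
Qed.

Lemma primitive_nd x y : 0 <= x -> x <= y -> primitive x <= primitive y.
Proof.
move=> x0 xy; rewrite -subr_ge0 primitiveB//; apply: Rintegral_ge0 => t /=.
by rewrite in_itv/= => /andP[xt _]; apply/sigma_ge0/ltW/(le_lt_trans x0).
Qed.

Lemma primitive_lipschitz (c x y : R) : 0 <= x -> x <= y ->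
  (forall t, x <= t -> sigma t <= c) ->
  `|primitive y - primitive x| <= c * (y - x).
Proof.
move=> x0 xy sc.
rewrite ger0_norm ?subr_ge0 ?primitive_nd// primitiveB//.
have mxy : mu `]x, y] = (y - x)%:E.
  rewrite lebesgue_measure_itv/= lte_fin; case: ltP => // yx.
  by have -> : y = x; [apply/eqP; rewrite eq_le yx|rewrite subrr].
have -> : c * (y - x) = (\int[mu]_(t in `]x, y]) c)%R.
  by rewrite Rintegral_cst// [X in fine X]mxy.
apply: le_Rintegral => //.
- apply: integrableS (sigma_int (le_trans x0 xy)) => //.
  by apply: subset_itvr; rewrite bnd_simp.
- apply/integrableP; split; first exact: measurable_cst.
  by rewrite integral_cst// [X in (_ * X)%E]mxy -EFinM ltry.
- by move=> t /=; rewrite in_itv/= => /andP[/ltW xt _]; exact: sc.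
Qed.

(** The differentiation theorem needs a function defined, and locally
    integrable, on the whole line: sigma is cut off on the negative times. *)
Lemma primitive_derive : {ae mu, forall x, 0 < x ->
  is_derive (x : R^o) (1 : R^o) (primitive : R^o -> R^o) (sigma x)}.
Proof.
pose f := sigma \_ `[0, +oo[.
have fE y x : y \in `[0, x]%classic -> f y = sigma y.
  rewrite inE/= in_itv/= => /andP[y0 _].
  by rewrite /f patchE mem_set//= in_itv/= y0.
have f_int y : mu.-integrable `[0, y] (EFin \o f).
  have [y0|y0] := leP 0 y; last first.
    by rewrite set_itv_ge ?bnd_simp -?ltNge//; exact: integrable_set0.
  apply: eq_integrable (sigma_int y0) => // z zy /=.
  by rewrite (fE _ _ zy).
have f_loc : locally_integrable setT f.
  split; [|exact: openT|move=> C _ cC].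
    apply/(measurable_restrictT _ _).1 => //.
    rewrite itv_bndy_bigcup_BRight; apply/measurable_fun_bigcup => // n.
    have n0 : 0 <= 0 + n%:R :> R by rewrite add0r.
    by have /integrableP[/measurable_EFinP] := sigma_int n0.
  have [M [Mr HM]] := compact_bounded cC.
  pose B := Num.max 0 (M + 1).
  have B0 : 0 <= B by rewrite le_max lexx.
  have [_ _ /(_ C (@subsetT _ _) cC)] :=
    integrable_locally (measurable_itv _) (sigma_int B0).
  apply: le_lt_trans; rewrite le_eqVlt; apply/orP; left; apply/eqP.
  apply: eq_integral => z zC; congr (`|_%:E|)%E.
  rewrite /f !patchE; congr (if _ then _ else _).
  apply/idP/idP; rewrite !inE/= !in_itv/= ?andbT; last by case/andP.
  move=> ->/=; rewrite (le_trans (ler_norm _))//.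
  rewrite (@le_trans _ _ (M + 1))// ?le_max ?lexx ?orbT//.
  by apply: HM; [rewrite ltrDl|rewrite inE in zC].
have := FTC1 f_int f_loc; apply: filterS.
  exact: (ae_filter_ringOfSetsType mu).
move=> x H x0; have [|dK Kx] := H; first by rewrite lte_fin.
have FE : (fun x0 => \int[mu]_(t in `[0, x0]) f t)%R = primitive.
  by apply/funext => y; apply: eq_Rintegral => z; exact: fE.
rewrite FE in dK Kx.
apply: DeriveDef => //; rewrite -derive1E Kx.
by apply: (fE _ x); rewrite inE/= in_itv/= lexx ltW.
Qed.

Lemma primitive_unbounded :
  (\int[mu]_(t in `[0%R, +oo[) (sigma t)%:E = +oo)%E ->
  forall A, exists2 t, 0 <= t & A <= primitive t.
Proof.
rewrite itv_bndy_bigcup_BRight => soo A.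
have n0 n : 0 <= 0 + n%:R :> R by rewrite add0r.
pose F n : set (measurableTypeR R) := `[0, 0 + n%:R : R]%classic.
have : (\int[mu]_(t in F n) (sigma t)%:E)%E @[n --> \oo] --> +oo%E.
  rewrite -soo; apply: ge0_nondecreasing_set_cvg_integral.
  - move=> n m nm; rewrite subsetEset; apply: subset_itvl.
    by rewrite bnd_simp lerD2l ler_nat.
  - by move=> n; exact: measurable_itv.
  - by move=> n; have /integrableP[] := sigma_int (n0 n).
  - by move=> n x; rewrite /F/= in_itv/= lee_fin => /andP[/sigma_ge0].
move=> /cvgeyPge/(_ A)[n _ /(_ n (leqnn n)) An]; exists (0 + n%:R) => //.
rewrite -lee_fin /primitive /Rintegral fineK//.
by apply: integrable_fin_num => //; exact: sigma_int.
Qed.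

End primitive.

(** * Convex functions of one real variable *)

Section convex_real_functions.
Variable R : realType.

Lemma convex_functionR_le (f : R -> R) (t x z : R) :
  convex_function (E := R^o) setT f -> 0 <= t -> t <= 1 ->
  f (t * x + (1 - t) * z) <= t * f x + (1 - t) * f z.
Proof.
by move=> cf t0 t1; have := cf (Itv01 t0 t1) x z; rewrite !inE/=; exact.
Qed.

(** Convexity bounds the difference quotients at x towards z by f z - f x; the
    slack e is what a small but positive step t costs. *)
Lemma convex_tangent_le (f : R -> R) (x z : R) :
  convex_function (E := R^o) setT f -> derivable (f : R^o -> R^o) x 1 ->
  f x + derive1 (f : R -> R^o) x * (z - x) <= f z.
Proof.
move=> cf dfx; set d := derive1 _ x.
have df : is_derive (x : R^o) (1 : R^o) (f : R^o -> R^o) d.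
  by apply: DeriveDef => //; rewrite -derive1E.
apply/ler_addgt0Pr => e e0.
have e1 : 0 < e / (`|z - x| + 1) by rewrite divr_gt0// ltr_wpDl.
have [r r0 H] := is_derive_near e1 df.
pose t := Num.min 1 (r / (`|z - x| + 1) / 2).
have t0 : 0 < t by rewrite lt_min ltr01 !divr_gt0// ltr_wpDl.
have t1 : t <= 1 by rewrite ge_min lexx.
have tr : t * `|z - x| < r.
  have : t <= r / (`|z - x| + 1) / 2 by rewrite ge_min lexx orbT.
  rewrite ler_pdivlMr// ler_pdivlMr ?ltr_wpDl// mulrDr mulr1.
  have : 0 <= t * `|z - x| by rewrite mulr_ge0// ltW.
  lra.
have := convex_functionR_le z x cf (ltW t0) t1.
have -> : t * z + (1 - t) * x = x + t * (z - x) by ring.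
have := H (x + t * (z - x)).
rewrite addrC addKr normrM (gtr0_norm t0) => /(_ tr).
rewrite ler_norml => /andP[+ _].
have ee : e / (`|z - x| + 1) * `|z - x| <= e.
  rewrite -mulrA; apply: ler_piMr; first exact: ltW.
  by rewrite mulrC ler_pdivrMr ?ltr_wpDl// mul1r lerDl.
have H1 := ler_wpM2l (ltW t0) ee => H3 H2.
rewrite -(ler_pM2l t0).
have E2 : e / (`|z - x| + 1) * (t * `|z - x|) =
    t * (e / (`|z - x| + 1) * `|z - x|) by ring.
move: H1 H2 H3; rewrite E2; move: (t * (_ * _)) (f (x + _)) => E1 w.
have -> : d * (t * (z - x)) = t * (d * (z - x)) by ring.
rewrite !mulrDr mulrBl mul1r; move: (t * f x) (t * f z) (t * e) (t * (d * _)).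
by move=> *; lra.
Qed.

(** By convexity the growth of F along a ray from xs is at least the one reached
    at distance e, so only the two points at distance e matter. *)
Lemma unique_minimizer_gap (F : R -> R) (xs e : R) :
  convex_function (E := R^o) setT F -> unique_minimizer F xs -> 0 < e ->
  exists2 d : R, 0 < d & forall x, e <= `|x - xs| -> d <= F x - F xs.
Proof.
move=> cF [Fmin Funiq] e0.
have Flt x : x != xs -> F xs < F x.
  move=> xxs; rewrite lt_neqAle Fmin andbT; apply: contra_neq xxs => Fx.
  by apply: Funiq => z; rewrite -Fx.
have ray s x : `|s| = e -> 0 < (x - xs) / s -> e <= `|x - xs| ->
    F (xs + s) - F xs <= F x - F xs.
  move=> se xs0 ex.
  have s0 : s != 0 by rewrite -normr_gt0 se.
  have xs1 : 1 <= (x - xs) / s.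
    by rewrite -(gtr0_norm xs0) normrM normfV se ler_pdivlMr// mul1r.
  have q1 : ((x - xs) / s)^-1 <= 1 by rewrite invf_le1.
  have q0 : 0 <= ((x - xs) / s)^-1 by rewrite invr_ge0 ltW.
  have := convex_functionR_le x xs cF q0 q1.
  set q := _^-1 in q0 q1 *.
  have -> : q * x + (1 - q) * xs = xs + s.
    have -> : q * x + (1 - q) * xs = xs + q * (x - xs) by ring.
    congr (_ + _); rewrite /q invf_div divfK//.
    by apply: contraTneq xs0 => ->; rewrite mul0r ltxx.
  have := Fmin x.
  have : 0 <= (1 - q) * (F x - F xs) by rewrite mulr_ge0 ?subr_ge0.
  lra.
exists (Num.min (F (xs + e) - F xs) (F (xs - e) - F xs)).
  rewrite lt_min !subr_gt0 !Flt//.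
    by rewrite lt_eqF// gtrBl.
  by rewrite gt_eqF// ltrDl.
move=> x ex; rewrite ge_min.
have [xxs|xxs] := leP xs x.
  have x0 : 0 < x - xs.
    by move: ex; rewrite ger0_norm ?subr_ge0//; exact: lt_le_trans.
  by rewrite ray// ?gtr0_norm// divr_gt0.
rewrite orbC ray//; first by rewrite normrN gtr0_norm.
by rewrite invrN mulrN -mulNr divr_gt0// oppr_gt0 subr_lt0.
Qed.

Lemma convex_function_sum (J : finType) (f : J -> R -> R) :
  (forall j, convex_function (E := R^o) setT (f j)) ->
  convex_function (E := R^o) setT (fun x => \sum_j f j x).
Proof.
move=> cf t x z xT zT; rewrite convRE !mulr_sumr -big_split/=.
by apply: ler_sum => j _; have := cf j t x z xT zT; rewrite convRE.
Qed.

End convex_real_functions.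

(** * Laplacian of a weighted graph *)

Section mean.
Variables (R : realType) (J : finType).
Implicit Types z : J -> R.

Definition mean z : R := (\sum_j z j) / #|J|%:R.

Lemma sum_dev_mean z : \sum_j (z j - mean z) = 0.
Proof.
rewrite sumrB sumr_const; have [J0|J0] := eqVneq #|J| 0%N.
  rewrite J0 mulr0n subr0 big_pred0// => j.
  by have := max_card (pred1 j); rewrite card1 J0.
by rewrite -mulr_natr /mean divfK ?subrr// pnatr_eq0.
Qed.

(** The cross term of the expansion vanishes because the deviations from the
    mean add up to zero. *)
Lemma sum_sqr_mean z (a : R) :
  \sum_j (z j - a) ^+ 2 =
  \sum_j (z j - mean z) ^+ 2 + #|J|%:R * (mean z - a) ^+ 2.
Proof.
have -> : #|J|%:R * (mean z - a) ^+ 2 = \sum_(j : J) (mean z - a) ^+ 2.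
  by rewrite sumr_const mulr_natl.
have : 2 * (mean z - a) * \sum_j (z j - mean z) = 0.
  by rewrite sum_dev_mean mulr0.
rewrite mulr_sumr => H; rewrite -big_split -[RHS]addr0 -[X in _ = _ + X]H -big_split.
by apply: eq_bigr => j _ /=; ring.
Qed.

Lemma sum_sqr_mean_le z (a : R) :
  \sum_j (z j - mean z) ^+ 2 <= \sum_j (z j - a) ^+ 2.
Proof. by rewrite (sum_sqr_mean z a) lerDl mulr_ge0// sqr_ge0. Qed.

End mean.

Section graph_laplacian.
Variables (R : realType) (J : finType) (c : J -> J -> R).
Hypothesis c_sym : forall p q, c p q = c q p.
Hypothesis c_ge0 : forall p q, 0 <= c p q.
Implicit Types z : J -> R.

Definition graph_laplacian z (p : J) : R := \sum_q c p q * (z p - z q).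

Lemma graph_laplacian_sum0 z : \sum_p graph_laplacian z p = 0.
Proof.
have : \sum_p graph_laplacian z p = - \sum_p graph_laplacian z p.
  rewrite {1}/graph_laplacian [LHS]exchange_big -sumrN; apply: eq_bigr => p _.
  rewrite /graph_laplacian -sumrN; apply: eq_bigr => q _.
  by rewrite c_sym -mulrN opprB.
lra.
Qed.

(** Twice the quadratic form of the Laplacian, as a sum of squares. *)
Let energy z := \sum_p \sum_q c p q * (z p - z q) ^+ 2.

Let energyE z : energy z = 2 * \sum_p z p * graph_laplacian z p.
Proof.
have E1 : \sum_p z p * graph_laplacian z p = \sum_p \sum_q c p q * (z p - z q) * z p.
  by apply: eq_bigr => p _; rewrite mulr_sumr; apply: eq_bigr => q _; rewrite mulrC.
have E2 : \sum_p z p * graph_laplacian z p = - \sum_p \sum_q c p q * (z p - z q) * z q.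
  rewrite E1 exchange_big -sumrN; apply: eq_bigr => p _; rewrite -sumrN.
  by apply: eq_bigr => q _; rewrite c_sym; ring.
rewrite mulr2n mulrDl mul1r {1}E1 E2 -sumrB; apply: eq_bigr => p _.
by rewrite -sumrB; apply: eq_bigr => q _; ring.
Qed.

Let energy_ge z p q : c p q * (z p - z q) ^+ 2 <= energy z.
Proof.
rewrite /energy (bigD1 p)//= (bigD1 q)//= -addrA lerDl addr_ge0//.
  by apply: sumr_ge0 => i _; rewrite mulr_ge0// sqr_ge0.
by apply: sumr_ge0 => i _; apply: sumr_ge0 => j _; rewrite mulr_ge0// sqr_ge0.
Qed.

Let energy_ge0 z : 0 <= energy z.
Proof.
by apply: sumr_ge0 => i _; apply: sumr_ge0 => j _; rewrite mulr_ge0// sqr_ge0.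
Qed.

(** Along a path the squared differences are controlled one edge at a time,
    since (a + b)^2 <= 2 a^2 + 2 b^2. *)
Let connect_energy p q : connect [rel x y | 0 < c x y] p q ->
  exists2 C : R, 0 <= C & forall z, (z p - z q) ^+ 2 <= C * energy z.
Proof.
move=> /connectP[s]; elim: s p => [p _ ->|r s IH p /= /andP[pr rs] qE].
  by exists 0 => // z; rewrite subrr expr0n mul0r.
have [C C0 HC] := IH _ rs qE.
exists (2 * (c p r)^-1 + 2 * C).
  by rewrite addr_ge0// mulr_ge0// invr_ge0.
move=> z; have := HC z.
have : (z p - z r) ^+ 2 <= (c p r)^-1 * energy z.
  by rewrite ler_pdivlMl// energy_ge.
have := sqr_ge0 ((z p - z r) - (z r - z q)).
have -> : z p - z q = (z p - z r) + (z r - z q) by ring.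
move: (z p - z r) (z r - z q) (_^-1) (energy z) => a b k w; nra.
Qed.

(** Poincare inequality of a connected graph.  The deviation from the mean is at
    most the deviation from the value at a fixed vertex q0, which the energy
    controls along a path to q0. *)
Lemma graph_laplacian_gap :
  (forall p q, connect [rel x y | 0 < c x y] p q) ->
  exists2 lam : R, 0 < lam & forall z,
    lam * \sum_p (z p - mean z) ^+ 2 <= \sum_p z p * graph_laplacian z p.
Proof.
move=> conn.
have [q0|J0] := pickP (fun _ : J => true); last first.
  by exists 1 => // z; rewrite !big_pred0 ?mulr0// => j; have := J0 j.
move=> _.
have /choice[C HC] p : exists C : R, 0 <= C /\
    forall z, (z p - z q0) ^+ 2 <= C * energy z.
  by have [C] := connect_energy (conn p q0); exists C.
pose S := \sum_p C p.
have S0 : 0 <= S by apply: sumr_ge0 => p _; case: (HC p).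
exists ((2 * (S + 1))^-1); first by rewrite invr_gt0 mulr_gt0// ltr_wpDl.
move=> z; rewrite ler_pdivrMl ?mulr_gt0// ?ltr_wpDl//.
rewrite -mulrA mulrCA -energyE.
apply: (le_trans (sum_sqr_mean_le z (z q0))).
apply: (@le_trans _ _ (S * energy z)).
  by rewrite mulr_suml; apply: ler_sum => p _; case: (HC p).
by rewrite ler_wpM2r// lerDl.
Qed.

End graph_laplacian.

(** * Diffusive gradient flows *)

Section derivatives.
Variable R : realType.
Local Notation is_deriv x g dg := (is_derive (x : R^o) (1 : R^o) (g : R^o -> R^o) dg).

Lemma is_derive_fsum (J : finType) (x : R) (g : J -> R -> R) (dg : J -> R) :
  (forall j, is_deriv x (g j) (dg j)) ->
  is_deriv x (fun t => \sum_j g j t) (\sum_j dg j).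
Proof.
move=> gd; elim: (index_enum J) => [|j r IH].
  rewrite big_nil; have -> : (fun t => \sum_(j <- [::]) g j t) = cst 0.
    by apply/funext => t; rewrite big_nil.
  exact: is_derive_cst.
rewrite big_cons; have -> : (fun t => \sum_(k <- j :: r) g k t) =
    (g j : R^o -> R^o) + (fun t => \sum_(k <- r) g k t).
  by apply/funext => t; rewrite big_cons.
exact: is_deriveD.
Qed.

Lemma is_derive_sqr (x : R) (g : R -> R) (dg : R) :
  is_deriv x g dg -> is_deriv x (fun t => g t ^+ 2) (2 * g x * dg).
Proof.
move=> gd; have -> : (fun t => g t ^+ 2) = (g : R^o -> R^o) ^+ 2.
  by apply/funext => t; rewrite !expr2.
apply: is_derive_eq (@is_deriveX _ _ (g : R^o -> R^o) 2 _ _ _ gd) _.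
by rewrite expr1.
Qed.

Lemma is_derive_subc (x : R) (g : R -> R) (dg a : R) :
  is_deriv x g dg -> is_deriv x (fun t => g t - a) dg.
Proof.
move=> gd; rewrite -[dg]subr0.
exact: (@is_deriveB _ _ _ (g : R^o -> R^o) (cst a : R^o -> R^o)).
Qed.

Lemma is_derive_add (x : R) (g h : R -> R) (dg dh : R) :
  is_deriv x g dg -> is_deriv x h dh -> is_deriv x (fun t => g t + h t) (dg + dh).
Proof.
by move=> gd hd; exact: (@is_deriveD _ _ _ (g : R^o -> R^o) (h : R^o -> R^o)).
Qed.

Lemma is_derive_sub (x : R) (g h : R -> R) (dg dh : R) :
  is_deriv x g dg -> is_deriv x h dh -> is_deriv x (fun t => g t - h t) (dg - dh).
Proof.
by move=> gd hd; exact: (@is_deriveB _ _ _ (g : R^o -> R^o) (h : R^o -> R^o)).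
Qed.

Lemma is_derive_mulc (x : R) (g : R -> R) (dg a : R) :
  is_deriv x g dg -> is_deriv x (fun t => a * g t) (a * dg).
Proof. by move=> gd; exact: (@is_deriveZ _ _ _ (g : R^o -> R^o) a _ _ _ gd). Qed.

End derivatives.

(** The flow u_j' = - sigma phi_j'(u_j) - (L u)_j on a finite set of agents.  The
    costs enter through the tangent inequality, the Lipschitz derivative, the
    gap of the minimum on the diagonal and a coercivity bound; the operator L
    enters through its zero sum and its dissipation of the deviation from the
    mean. *)
Section diffusive_gradient_flow.
Variables (R : realType) (J : finType) (phi dphi : J -> R -> R).
Variables (L : (J -> R) -> J -> R) (sigma : R -> R) (u : J -> R -> R).
Variables (xs k lam c : R).
Local Notation mu := (@lebesgue_measure R).
Local Notation is_deriv x g dg := (is_derive (x : R^o) (1 : R^o) (g : R^o -> R^o) dg).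
Local Notation ac s t h := (@absolutely_continuous R R^o s t h).

Let excess (z : J -> R) := \sum_j phi j (z j) - \sum_j phi j xs.

Hypothesis tangent : forall j x z, phi j x + dphi j x * (z - x) <= phi j z.
Hypothesis lip : forall j x z, `|dphi j x - dphi j z| <= k * `|x - z|.
Hypothesis gap : forall e, 0 < e -> exists2 d, 0 < d &
  forall x, e <= `|x - xs| -> d <= \sum_j phi j x - \sum_j phi j xs.
Hypothesis coercive : forall z, c <= \sum_j (z j - xs) ^+ 2 -> 0 <= excess z.
Hypothesis L_sum0 : forall z, \sum_j L z j = 0.
Hypothesis lam0 : 0 < lam.
Hypothesis L_gap : forall z,
  lam * \sum_j (z j - mean z) ^+ 2 <= \sum_j z j * L z j.
Hypothesis sigma_gt0 : forall t, 0 <= t -> 0 < sigma t.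
Hypothesis sigma_int : forall t, 0 <= t -> mu.-integrable `[0, t] (EFin \o sigma).
Hypothesis sigma_oo : (\int[mu]_(t in `[0%R, +oo[) (sigma t)%:E = +oo)%E.
Hypothesis sigma_vanish : forall e, 0 < e ->
  exists2 T, 0 <= T & forall t, T <= t -> sigma t <= e.
Hypothesis acu : forall j t, 0 <= t -> ac 0 t (u j).

Let state t : J -> R := u ^~ t.
Let flow t := forall j,
  is_deriv t (u j) (- (sigma t * dphi j (u j t)) - L (state t) j).
Hypothesis uflow : {ae mu, forall t, 0 < t -> flow t}.

Let V t := \sum_j (u j t - xs) ^+ 2.
Let Q t := \sum_j (u j t - mean (state t)) ^+ 2.

Let excess_le z : excess z <= \sum_j (z j - xs) * dphi j (z j).
Proof.
rewrite /excess -sumrB; apply: ler_sum => j _.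
have := tangent j (z j) xs; lra.
Qed.

Let L_dev z a : \sum_j (z j - a) * L z j = \sum_j z j * L z j.
Proof.
under eq_bigr do rewrite mulrBl; rewrite sumrB -[X in _ - X]mulr_sumr.
by rewrite L_sum0 mulr0 subr0.
Qed.

Let L_ge0 z : 0 <= \sum_j z j * L z j.
Proof.
apply: le_trans (L_gap z); apply: mulr_ge0; first exact: ltW.
by apply: sumr_ge0 => j _; exact: sqr_ge0.
Qed.

Let acV t : 0 <= t -> ac 0 t V.
Proof.
move=> t0; apply: ac_sum => j; apply: acM; apply: acD (acu j t0) _; exact: ac_cst.
Qed.

Let acQ t : 0 <= t -> ac 0 t Q.
Proof.
move=> t0; apply: ac_sum => j.
have acm : ac 0 t (fun s => - mean (state s)).
  have -> : (fun s => - mean (state s)) =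
      fun s => (\sum_j u j s) * (- (#|J|%:R)^-1).
    by apply/funext => s; rewrite /mean mulrN.
  apply: acM; last exact: ac_cst.
  by apply: ac_sum => i; exact: acu.
by apply: acM; apply: acD (acu j t0) _.
Qed.

(** The diffusion does not increase the distance to a consensus state, and by
    the tangent inequality the gradient decreases it at a rate given by the
    excess cost. *)
Let dV t : 0 <= t -> flow t ->
  exists2 d, d <= - (2 * sigma t * excess (state t)) & is_deriv t V d.
Proof.
move=> t0 ft.
pose du j := - (sigma t * dphi j (u j t)) - L (state t) j.
exists (\sum_j 2 * (u j t - xs) * du j).
  have -> : \sum_j 2 * (u j t - xs) * du j =
      - (2 * sigma t * \sum_j (state t j - xs) * dphi j (state t j))
      - 2 * \sum_j (state t j - xs) * L (state t) j.
    rewrite !mulr_sumr -!sumrN -big_split/=.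
    by apply: eq_bigr => j _; rewrite /du /state; ring.
  rewrite L_dev; have := L_ge0 (state t).
  have := ler_wpM2l (ltW (sigma_gt0 t0)) (excess_le (state t)); lra.
apply: is_derive_fsum => j; apply: is_derive_sqr; exact: is_derive_subc.
Qed.

(** The motion of the mean does not contribute, since the deviations from the
    mean add up to zero. *)
Let dQ t : flow t -> is_deriv t Q
  (- (2 * sigma t * \sum_j (u j t - mean (state t)) * dphi j (u j t))
   - 2 * \sum_j u j t * L (state t) j).
Proof.
move=> ft.
pose du j := - (sigma t * dphi j (u j t)) - L (state t) j.
have dm : is_deriv t (fun s => mean (state s)) ((#|J|%:R)^-1 * \sum_j du j).
  have -> : (fun s => mean (state s)) = fun s => (#|J|%:R)^-1 * \sum_j u j s.
    by apply/funext => s; rewrite /mean mulrC.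
  by apply: is_derive_mulc; apply: is_derive_fsum.
set dm' := _ * _ in dm.
apply: (@is_derive_eq _ _ _ _ _ _ _
    (\sum_j 2 * (u j t - mean (state t)) * (du j - dm'))).
  apply: is_derive_fsum => j; apply: is_derive_sqr; exact: is_derive_sub.
rewrite -[X in _ = _ - 2 * X](L_dev (state t) (mean (state t))).
have dm0 : - (2 * dm') * \sum_j (state t j - mean (state t)) = 0.
  by rewrite sum_dev_mean mulr0.
rewrite -[RHS]addr0 -[X in _ = _ + X]dm0 !mulr_sumr -!sumrN -!big_split/=.
by apply: eq_bigr => j _; rewrite /state /du; ring.
Qed.

(** The squared distance V decreases whenever it exceeds c, since the excess
    cost is then nonnegative. *)
Let flow_bounded : exists2 C, 0 <= C & forall t, 0 <= t -> V t <= C.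
Proof.
have V0 : 0 <= V 0 by rewrite /V; apply: sumr_ge0 => j _; exact: sqr_ge0.
exists (Num.max c (V 0)); first by rewrite le_max V0 orbT.
move=> t t0; apply: (@ac_stay_below R 0 _ V (fun=> 0) acV _ _ _ 0 t) => //.
- by move=> s _; exact: ac_cst.
- have := uflow; apply: filterS; first exact: (ae_filter_ringOfSetsType mu).
  move=> s fs s0; rewrite gt_max => /andP[cV _].
  have [d dle dd] := dV (ltW s0) (fs s0).
  exists d.
    apply: le_trans dle _; rewrite oppr_le0 mulr_ge0//.
      by rewrite mulr_ge0// ltW// sigma_gt0// ltW.
    by apply: coercive; exact: ltW.
  by under [X in is_derive _ _ X]eq_fun do rewrite addr0.
- by rewrite le_max lexx orbT.
Qed.

Let G0 : R := \sum_j 2 * dphi j xs ^+ 2.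

Let G0_ge0 : 0 <= G0.
Proof. by rewrite /G0; apply: sumr_ge0 => j _; rewrite mulr_ge0// sqr_ge0. Qed.

Let k2_ge0 : 0 <= 2 * k ^+ 2.
Proof. by rewrite mulr_ge0// sqr_ge0. Qed.

Let grad_sqr z : \sum_j dphi j (z j) ^+ 2 <=
  G0 + 2 * k ^+ 2 * \sum_j (z j - xs) ^+ 2.
Proof.
rewrite mulr_sumr -big_split/=; apply: ler_sum => j _.
have k0 : 0 <= k * `|z j - xs| by apply: le_trans (lip j (z j) xs).
have : `|dphi j (z j) - dphi j xs| ^+ 2 <= (k * `|z j - xs|) ^+ 2.
  by rewrite ler_sqr ?nnegrE.
rewrite exprMn !real_normK ?num_real//.
have := sqr_ge0 (dphi j (z j) - 2 * dphi j xs); lra.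
Qed.

(** The weight q lets either of the two sums be made small at the expense of the
    other. *)
Let young (a b : J -> R) (q : R) : 0 < q ->
  `|\sum_j a j * b j| <= (q * (\sum_j b j ^+ 2) + q^-1 * (\sum_j a j ^+ 2)) / 2.
Proof.
move=> q0; apply: le_trans (ler_norm_sum _ _ _) _.
rewrite !mulr_sumr -big_split/= mulr_suml; apply: ler_sum => j _.
rewrite ler_pdivlMr// normrM -[b j ^+ 2]real_normK ?num_real//.
rewrite -[a j ^+ 2]real_normK ?num_real//.
move: `|a j| `|b j| => x y; rewrite -subr_ge0.
have -> : q * y ^+ 2 + q^-1 * x ^+ 2 - x * y * 2 = q^-1 * (q * y - x) ^+ 2.
  by field; rewrite gt_eqF.
by rewrite mulr_ge0 ?sqr_ge0// invr_ge0 ltW.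
Qed.

(** On the bounded trajectory the gradient is bounded, so its contribution to
    the derivative of Q is O(sigma).  Once this is below lam e, the dissipation
    2 lam Q of the diffusion makes Q decrease at a rate of at least lam e as
    long as Q > e. *)
Let consensus (e : R) : 0 < e ->
  exists2 T, 0 <= T & forall t, T <= t -> Q t <= e.
Proof.
move=> e0; have [C C0 VC] := flow_bounded.
(* Bound of the pairing of the gradient with the deviation from the mean. *)
pose B := (G0 + 2 * k ^+ 2 * C + C) / 2.
have B0 : 0 <= B by rewrite divr_ge0// !addr_ge0//; exact: mulr_ge0.
have s0 : 0 < lam * e / (2 * (B + 1)) by rewrite divr_gt0 ?mulr_gt0// ltr_wpDl.
have [T T0 sT] := sigma_vanish s0.
have le0 : 0 < lam * e by rewrite mulr_gt0.
have [|||||t0 Tt0 Qt0] := @ac_eventually_below R T e Q (fun t => lam * e * t).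
- by move=> t Tt; apply: ac_sub (acQ (le_trans T0 Tt)).
- move=> t Tt; apply: (@ac_lipschitz R R^o T t (lam * e)) => x z _ xz _.
  by rewrite -mulrBr ger0_norm// mulr_ge0 ?subr_ge0// ltW.
- by move=> x y _ xy; rewrite ler_pM2l.
- have := uflow; apply: filterS; first exact: (ae_filter_ringOfSetsType mu).
  move=> t ft Tt eQ; have t0 : 0 < t by exact: le_lt_trans Tt.
  exists (- (2 * sigma t * \sum_j (u j t - mean (state t)) * dphi j (u j t))
    - 2 * \sum_j u j t * L (state t) j + lam * e * 1); last first.
    by apply: is_derive_add; first exact/dQ/ft.
  have QV : Q t <= V t by exact: sum_sqr_mean_le.
  have S1 : `|\sum_j (u j t - mean (state t)) * dphi j (u j t)| <= B.
    apply: le_trans (young _ _ ltr01) _.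
    rewrite invr1 !mul1r ler_pM2r ?invr_gt0// lerD//; last first.
      exact: le_trans (VC _ (ltW t0)).
    apply: le_trans (grad_sqr (state t)) _.
    by rewrite lerD2l ler_wpM2l// VC// ltW.
  have S2 : sigma t * (2 * (B + 1)) <= lam * e.
    by rewrite -ler_pdivlMr ?sT ?ltW// mulr_gt0// ltr_wpDl.
  have S3 : lam * e < lam * Q t by rewrite ltr_pM2l.
  have S4 := L_gap (state t); rewrite -/(Q t) in S4.
  have st0 := sigma_gt0 (ltW t0).
  move: S1; rewrite ler_norml => /andP[S1 _].
  have S5 := ler_wpM2l (ltW st0) S1.
  rewrite mulr1; move: S2 S3 S4 S5; rewrite /state.
  move: (\sum_j _ * dphi j _) (\sum_j _ * L _ j) (lam * Q t) (lam * e) => S P q r.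
  lra.
- move=> A; exists (Num.max T (A / (lam * e))); first by rewrite le_max lexx.
  by rewrite -ler_pdivrMl// mulrC le_max lexx orbT.
by exists t0 => //; exact: le_trans Tt0.
Qed.

Let card_gt0 : 0 < #|J|%:R :> R.
Proof.
rewrite ltr0n lt0n; apply/eqP => J0.
have JF : (fun _ : J => true) =1 xpred0.
  by move=> j; have := max_card (pred1 j); rewrite card1 J0.
have [d d0 /(_ (xs + 1))] := gap ltr01.
rewrite addrC addKr normr1 lexx => /(_ isT).
by rewrite !big_pred0// subrr leNgt d0.
Qed.

(** Split V t = Q t + n (m - xs)^2, with n the number of agents and m the mean.
    When V t > e while Q t <= e / 2, the mean is at distance at least r from xs,
    so the cost at the consensus state m exceeds the minimum by d; for Q small
    the tangent inequality at m transfers half of this excess to the actual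
    state.  Hence V' <= - sigma d as long as V > e, and the divergence of the
    integral of sigma brings V below e. *)
Lemma diffusive_gradient_flow_cvg (e : R) : 0 < e ->
  exists T, forall t, T <= t -> \sum_j (u j t - xs) ^+ 2 <= e.
Proof.
move=> e0; have [C C0 VC] := flow_bounded.
pose r := Num.sqrt (e / 2 / #|J|%:R).
have r0 : 0 < r by rewrite sqrtr_gt0 !divr_gt0.
have r2 : r ^+ 2 = e / 2 / #|J|%:R by rewrite sqr_sqrtr// !divr_ge0// ltW.
have [d d0 Hd] := gap r0.
pose B := G0 + 2 * k ^+ 2 * C.
have B0 : 0 <= B by rewrite addr_ge0//; exact: mulr_ge0.
(* This weight makes the gradient part of the Young inequality at most d / 2;
   the bound q * d / 2 on Q does the same for the deviation part. *)
pose q := d / (2 * (B + 1)).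
have q0 : 0 < q by rewrite divr_gt0// mulr_gt0// ltr_wpDl.
have eta0 : 0 < Num.min (e / 2) (q * d / 2).
  by rewrite lt_min !divr_gt0// mulr_gt0.
have [T1 T10 QT1] := consensus eta0.
have [T2 T20 sT2] := sigma_vanish ltr01.
pose T := Num.max T1 T2.
have T0 : 0 <= T by rewrite le_max T10.
have s0 t : 0 <= t -> 0 <= sigma t by move=> t0; exact/ltW/sigma_gt0.
have [|||||t0 Tt0 Vt0] :=
  @ac_eventually_below R T e V (fun t => d * primitive sigma t).
- by move=> t Tt; apply: ac_sub (acV (le_trans T0 Tt)).
- move=> t Tt; apply: (@ac_lipschitz R R^o T t (d * 1)) => x z Tx xz _.
  rewrite -mulrBr normrM (gtr0_norm d0) -mulrA ler_pM2l//.
  apply: primitive_lipschitz => //; first exact: le_trans Tx.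
  move=> s xs'; apply: sT2; apply: le_trans xs'; apply: le_trans Tx.
  by rewrite le_max lexx orbT.
- move=> x y Tx xy; rewrite ler_pM2l//; apply: primitive_nd => //.
  exact: le_trans Tx.
- have := primitive_derive sigma_int.
  apply: filterS2 uflow; first exact: (ae_filter_ringOfSetsType mu).
  move=> t ft pt Tt eV; have t0 : 0 < t by exact: le_lt_trans Tt.
  have [dv dvle dvd] := dV (ltW t0) (ft t0).
  exists (dv + d * sigma t); last first.
    apply: is_derive_add => //; apply: is_derive_mulc; exact: pt.
  set m := mean (state t).
  have Qt : Q t <= Num.min (e / 2) (q * d / 2).
    by apply: QT1; apply: le_trans (ltW Tt); rewrite le_max lexx.
  move: Qt; rewrite le_min => /andP[Qe Qq].
  have VQ : V t = Q t + #|J|%:R * (m - xs) ^+ 2 by exact: sum_sqr_mean.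
  have Q0 : 0 <= Q t by rewrite /Q; apply: sumr_ge0 => j _; exact: sqr_ge0.
  have rm : r <= `|m - xs|.
    rewrite -ler_sqr ?nnegrE//; last exact: ltW.
    rewrite r2 real_normK ?num_real// ler_pdivrMr// mulrC; lra.
  have gm := Hd _ rm.
  have S1 : `|\sum_j (u j t - m) * dphi j m| <= d / 2.
    apply: le_trans (young _ _ q0) _.
    rewrite ler_pM2r ?invr_gt0//.
    have P1 : q * \sum_j dphi j m ^+ 2 <= d / 2.
      apply: (@le_trans _ _ (q * (B + 1))).
        rewrite ler_pM2l//; apply: le_trans (grad_sqr (fun=> m)) _.
        rewrite sumr_const -[_ *+ #|_|]mulr_natl /B -addrA lerD2l.
        apply: ler_wpDr => //; apply: ler_wpM2l => //.
        have := VC _ (ltW t0); lra.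
      rewrite /q le_eqVlt; apply/orP; left; apply/eqP; field.
      by rewrite gt_eqF// ltr_wpDl.
    have P2 : q^-1 * Q t <= d / 2.
      by rewrite ler_pdivrMl// mulrA.
    by rewrite [leRHS](splitr d) lerD.
  have ex : d / 2 <= excess (state t).
    have : \sum_j phi j m + \sum_j (u j t - m) * dphi j m <=
        \sum_j phi j (state t j).
      rewrite -big_split/=; apply: ler_sum => j _.
      by have := tangent j m (u j t); rewrite mulrC.
    move: S1 gm; rewrite ler_norml => /andP[S1 _]; rewrite /excess.
    move: (\sum_j phi j m) (\sum_j phi j xs) (\sum_j phi j (state t j)) S1.
    move: (\sum_j _ * _) => *; lra.
  have := ler_wpM2l (s0 _ (ltW t0)) ex; lra.
- move=> A; have [t t0 At] := primitive_unbounded s0 sigma_int sigma_oo (A / d).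
  exists (Num.max T t); first by rewrite le_max lexx.
  rewrite -ler_pdivrMl// mulrC; apply: le_trans At _.
  by apply: primitive_nd => //; rewrite le_max lexx orbT.
by exists t0.
Qed.

End diffusive_gradient_flow.

(** * The multiplex supra-Laplacian and the supra-cost *)

Section multiplex.
Variables (R : realType) (N M : nat).
Implicit Types (G : multiplex R N M) (y : 'cV[R]_(M * N)).

(** The supra-graph as a single weighted graph on the replica nodes.  Within a
    layer the weight carries the diffusion constant; the interlayer branch is
    reached only for two distinct layers. *)
Definition replica_weight G (p q : 'I_M * 'I_N) : R :=
  if p.1 == q.1 then intra G p.1 * weight G p.1 p.2 q.2
  else if p.2 == q.2 then inter G p.1 q.1 else 0.

Lemma replica_weight_sym G p q : replica_weight G p q = replica_weight G q p.
Proof.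
rewrite /replica_weight; case: (eqVneq p.1 q.1) => [->|pq].
  by rewrite weight_sym.
by rewrite eq_sym; case: eqP => // _; rewrite inter_sym.
Qed.

Lemma replica_weight_ge0 G p q : 0 <= replica_weight G p q.
Proof.
rewrite /replica_weight; case: (eqVneq p.1 q.1) => [_|pq].
  by rewrite mulr_ge0 ?weight_ge0// ltW// intra_gt0.
by case: eqP => // _; rewrite inter_ge0.
Qed.

Lemma replica_link_weight G p q : replica_link G p q -> 0 < replica_weight G p q.
Proof.
rewrite /replica_link /replica_weight.
by case: (eqVneq p.1 q.1) => _/=; rewrite ?andbF ?orbF//; case: eqP.
Qed.

Lemma diffusion_graph_laplacian G y a i :
  diffusion G y a i =
  graph_laplacian (replica_weight G) (fun p => entry y p.1 p.2) (a, i).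
Proof.
rewrite /graph_laplacian -(pair_bigA _ (fun b j =>
  replica_weight G (a, i) (b, j) * (entry y a i - entry y b j)))/=.
rewrite (bigD1 a)//= /diffusion; congr (_ + _).
  rewrite mulr_sumr; apply: eq_bigr => j _.
  by rewrite /replica_weight/= eqxx mulrA.
apply: eq_bigr => b ba; rewrite (bigD1 i)//= big1 => [|j ji].
  by rewrite /replica_weight/= eq_sym (negbTE ba) eqxx addr0.
by rewrite /replica_weight/= eq_sym (negbTE ba) eq_sym (negbTE ji) mul0r.
Qed.

Lemma mxvec_index_eq (a b : 'I_M) (i j : 'I_N) :
  (mxvec_index a i == mxvec_index b j) = (a == b) && (i == j).
Proof.
rewrite /mxvec_index (inj_eq (@cast_ord_inj _ _ _)) (inj_eq enum_rank_inj).
by rewrite xpair_eqE.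
Qed.

(** The cost is separable: moving the coordinate (a, i) changes only the term
    f a i, so both difference quotients coincide. *)
Lemma gradient_supra_cost (f : 'I_M -> 'I_N -> R -> R) y a i :
  entry (gradient (@supra_cost R N M f) y) a i =
  derive1 (f a i : R -> R^o) (entry y a i).
Proof.
rewrite {1}/entry mxE /derive /derive1.
set d := (fun _ : R => _); set d' := (fun _ : R => _).
suff -> : d = d' by [].
apply/funext => h; rewrite /d /d' /=; congr (_ *: _).
have entryE b j : entry (h *: delta_mx (mxvec_index a i) ord0 + y) b j =
    entry y b j + (if (b == a) && (j == i) then h else 0).
  by rewrite /entry !mxE mxvec_index_eq eqxx andbT addrC; case: ifP;
    rewrite ?mulr1 ?mulr0.
rewrite /supra_cost /= -!sumrB (bigD1 a)//= -sumrB (bigD1 i)//= !big1 ?addr0.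
- by rewrite entryE !eqxx [h + _]addrC.
- move=> b ba; rewrite -sumrB big1// => j _.
  by rewrite entryE (negbTE ba) addr0 subrr.
- by move=> j ji; rewrite entryE eqxx (negbTE ji) addr0 subrr.
Qed.

Lemma le_entry_norm y a i : `|entry y a i| <= `|y|.
Proof.
rewrite [leRHS]/Num.Def.normr/= mx_normrE.
exact: (le_bigmax _ (fun ij => `|y ij.1 ij.2|) (mxvec_index a i, ord0)).
Qed.

Lemma norm_le_entry y (e : R) : 0 <= e -> (forall a i, `|entry y a i| <= e) ->
  `|y| <= e.
Proof.
move=> e0 ye; rewrite [leLHS]/Num.Def.normr/= mx_normrE.
apply: bigmax_le => // -[k l] _ /=; case/mxvec_indexP: k => a i.
by rewrite (ord1 l); exact: ye.
Qed.

Lemma ac_entry s t (y : R -> 'cV[R]_(M * N)) a i :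
  absolutely_continuous s t y ->
  @absolutely_continuous R R^o s t (fun x => entry (y x) a i).
Proof.
move=> acy e e0; have [d d0 H] := acy e e0; exists d => // n l r lr tr len.
apply: le_lt_trans (H n l r lr tr len); apply: ler_sum => k _.
by apply: le_trans (le_entry_norm (y (r k) - y (l k)) a i); rewrite /entry !mxE.
Qed.

Lemma is_derive_entry (t : R) (y : R -> 'cV[R]_(M * N)) dy a i :
  is_derive (t : R^o) (1 : R^o) y dy ->
  is_derive (t : R^o) (1 : R^o) (fun x => entry (y x) a i : R^o) (entry dy a i).
Proof.
move=> [dery <-]; apply: DeriveDef.
  exact: ((derivable_mxP _ _ _).1 dery).
by rewrite (derive_mx dery) /entry mxE.
Qed.

(** Radial unboundedness, stated with the squared Euclidean distance to the
    consensus state at xs instead of the max norm. *)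
Lemma radially_unbounded_coercive (f : 'I_M -> 'I_N -> R -> R) (xs A : R) :
  radially_unbounded (@supra_cost R N M f) ->
  exists c, forall z : 'I_M * 'I_N -> R,
    c <= \sum_p (z p - xs) ^+ 2 -> A <= \sum_p f p.1 p.2 (z p).
Proof.
move=> /(_ A)[B HB].
exists (\sum_(p : 'I_M * 'I_N) (`|B| + `|xs|) ^+ 2 + 1) => z cz.
pose y : 'cV[R]_(M * N) := (mxvec (\matrix_(a, i) z (a, i)))^T.
have yE a i : entry y a i = z (a, i) by rewrite /entry mxE mxvecE mxE.
have -> : \sum_p f p.1 p.2 (z p) = supra_cost f y.
  rewrite /supra_cost pair_bigA; apply: eq_bigr => -[a i] _ /=.
  by rewrite yE.
apply: HB; rewrite leNgt; apply/negP => yB.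
suff : \sum_p (z p - xs) ^+ 2 <= \sum_(p : 'I_M * 'I_N) (`|B| + `|xs|) ^+ 2.
  by move: cz; set S := \sum_p _; set S' := \sum_p _; lra.
apply: ler_sum => -[a i] _; rewrite -[leLHS]real_normK ?num_real//.
rewrite ler_sqr ?nnegrE ?addr_ge0//.
rewrite (le_trans (ler_normB _ _))// lerD2r -yE.
by rewrite (le_trans (le_entry_norm _ _ _))// (le_trans (ltW yB))// ler_norm.
Qed.

End multiplex.

Lemma lipschitzR_bound (R : realType) (g : R -> R) :
  [lipschitz (g x : R^o) | x in (setT : set R^o)] ->
  exists2 k : R, 0 <= k & forall x z, `|g x - g z| <= k * `|x - z|.
Proof.
move=> [m [_ H]]; exists (Num.max 0 (m + 1)); first by rewrite le_max lexx.
move=> x z; have := H (Num.max 0 (m + 1)).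
rewrite lt_max ltrDl ltr01 orbT => /(_ isT) Hk.
by have /= := Hk (x, z); apply.
Qed.

(** * Convergence of the multiplex gradient dynamics *)

Theorem theorem2 (R : realType) (N M : nat) (G : multiplex R N M)
  (f : 'I_M -> 'I_N -> R -> R) (xs : R) (sigma : R -> R)
  (G_connected : multiplex_connected G)
  (f_convex : forall a i, convex_function (E := R^o) setT (f a i))
  (f_derivable : forall a i (x : R), derivable (f a i : R^o -> R^o) x 1)
  (f_lipschitz : forall a i,
     [lipschitz (derive1 (f a i : R -> R^o) x : R^o) | x in (setT : set R^o)])
  (xs_min : unique_minimizer (total_cost f) xs)
  (F_unbounded : radially_unbounded (@supra_cost R N M f))
  (F_C2 : twice_continuously_differentiable (@supra_cost R N M f))
  (F_convex : convex_function (E := 'cV[R]_(M * N)) setT (@supra_cost R N M f))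
  (sigma_gt0 : forall t, 0 <= t -> 0 < sigma t)
  (sigma_integrable : forall s t, 0 <= s -> s <= t ->
     (@lebesgue_measure R).-integrable `[s, t] (EFin \o sigma))
  (sigma_persistent :
     (\int[@lebesgue_measure R]_(t in `[0%R, +oo[) (sigma t)%:E = +oo)%E)
  (sigma_cvg0 : sigma t @[t --> +oo] --> (0 : R^o)) :
  forall (y0 : 'cV[R]_(M * N)) (y : R -> 'cV[R]_(M * N)),
    multiplex_gradient_solution G f sigma y0 y ->
    y t @[t --> +oo] --> (const_mx xs : 'cV[R]_(M * N)).
Proof.
move=> y0 y [_ acy odey].
pose J := ('I_M * 'I_N)%type.
pose phi (p : J) := f p.1 p.2.
pose dphi (p : J) (x : R) := derive1 (phi p : R -> R^o) x.
pose u (p : J) t := entry (y t) p.1 p.2.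
have total_costE x : total_cost f x = \sum_p phi p x.
  by rewrite /total_cost pair_bigA.
have tangent p x z : phi p x + dphi p x * (z - x) <= phi p z.
  by apply: convex_tangent_le; [exact: f_convex|exact: f_derivable].
have [k lip] : exists k, forall p x z, `|dphi p x - dphi p z| <= k * `|x - z|.
  have /choice[K HK] (p : J) : exists k, 0 <= k /\
      forall x z, `|dphi p x - dphi p z| <= k * `|x - z|.
    by have [k] := lipschitzR_bound (f_lipschitz p.1 p.2); exists k.
  exists (\sum_p K p) => p x z; apply: le_trans ((HK p).2 x z) _.
  rewrite ler_wpM2r// (bigD1 p)//= lerDl.
  by apply: sumr_ge0 => q _; exact: (HK q).1.
have gap e : 0 < e -> exists2 d, 0 < d &
    forall x, e <= `|x - xs| -> d <= \sum_p phi p x - \sum_p phi p xs.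
  move=> e0; have [||//|d d0 Hd] := @unique_minimizer_gap R (total_cost f) xs e.
  - have -> : total_cost f = fun x => \sum_p phi p x by apply/funext.
    by apply: convex_function_sum => p; exact: f_convex.
  - exact: xs_min.
  - by exists d => // x /Hd; rewrite !total_costE.
have [c coercive] :=
  radially_unbounded_coercive xs (\sum_p phi p xs) F_unbounded.
have [lam lam0 L_gap] : exists2 lam : R, 0 < lam & forall z : J -> R,
    lam * \sum_p (z p - mean z) ^+ 2 <=
    \sum_p z p * graph_laplacian (replica_weight G) z p.
  apply: graph_laplacian_gap.
  - exact: replica_weight_sym.
  - exact: replica_weight_ge0.
  - move=> p q; apply: connect_sub (G_connected p q) => r s rs.
    by apply: connect1; exact: replica_link_weight.
have sigma_vanish e : 0 < e ->
    exists2 T, 0 <= T & forall t, T <= t -> sigma t <= e.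
  move=> e0; have /cvgrPdist_le/(_ e e0)[T [_ HT]] := sigma_cvg0.
  exists (Num.max 0 (T + 1)); first by rewrite le_max lexx.
  move=> t; rewrite ge_max => /andP[t0 Tt].
  have /HT : T < t by rewrite (lt_le_trans _ Tt)// ltrDl.
  by rewrite /= sub0r normrN; apply: le_trans; exact: ler_norm.
apply/cvgrPdist_le => /= e e0.
have e20 : 0 < e ^+ 2 by rewrite exprn_gt0.
have [|||||T HT] := @diffusive_gradient_flow_cvg R J phi dphi
  (graph_laplacian (replica_weight G)) sigma u xs k lam c tangent lip gap
  _ _ lam0 L_gap sigma_gt0 _ sigma_persistent sigma_vanish _ _ (e ^+ 2) e20.
- by move=> z /coercive; rewrite subr_ge0.
- by apply: graph_laplacian_sum0; exact: replica_weight_sym.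
- by move=> t t0; exact: sigma_integrable.
- by move=> p t t0; apply: ac_entry; exact: acy.
- have := odey; apply: filterS; first
    exact: (ae_filter_ringOfSetsType lebesgue_measure).
  move=> t ft t0 p; have := is_derive_entry p.1 p.2 (ft t0).
  have -> : entry (- (sigma t *: gradient (@supra_cost R N M f) (y t))
      - supra_laplacian G *m y t) p.1 p.2 =
      - (sigma t * entry (gradient (@supra_cost R N M f) (y t)) p.1 p.2)
      - entry (supra_laplacian G *m y t) p.1 p.2.
    by rewrite /entry !mxE.
  by rewrite gradient_supra_cost supra_laplacianE diffusion_graph_laplacian; case: p.
exists T; split; first exact: num_real.
move=> t Tt; apply: norm_le_entry => [|a i]; first exact: ltW.
rewrite /entry !mxE distrC -ler_sqr ?nnegrE//; last exact: ltW.
rewrite real_normK ?num_real//; apply: le_trans (HT t (ltW Tt)).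
rewrite (bigD1 (a, i))//= lerDl; apply: sumr_ge0 => p _; exact: sqr_ge0.
Qed.
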